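(* For every zero-sum mean-payoff game $\mathcal{G}$ with set of vertices $V$, every strategy $\sigma_0$ of Player 0, and every vertex $v\in V$: $$\forall \delta,\epsilon>0,\ \forall \mathcal{H}\in\mathcal{G}^{\pm\delta}:\quad \inf_{\sigma_1\in \mathsf{BR}^{\epsilon}_{1,\mathcal{H}}(\sigma_0)} \underline{\mathsf{MP}}_0^{\mathcal{H}}(\mathsf{Out}_v(\sigma_0,\sigma_1)) > \mathsf{Val}_{\mathcal{G}}(\sigma_0)(v)-\delta .$$
   Context: An arena $(V,E,\langle V_0,V_1\rangle,w_0,w_1)$ consists of a finite set $V$ of vertices, a set $E\subseteq V\times V$ of edges such that every vertex has at least one successor, a partition of $V$ into $V_0$ (Player 0) and $V_1$ (Player 1), and weight functions $w_0,w_1:E\to\mathbb{Z}$. A mean-payoff game $\mathcal{G}$ is played on such an arena. A play is an infinite path $\pi=\pi_0\pi_1\dots$; a history is a nonempty finite prefix of a play. The payoff of Player $i\in\{0,1\}$ is $\underline{\mathsf{MP}}_i(\pi)=\liminf_{k\to\infty}\frac1k w_i(\pi_0\dots\pi_k)$, where $w_i$ of a history is the sum of the $w_i$-weights of its edges; $\underline{\mathsf{MP}}^{\mathcal{G}}_i$ indicates that the weights of $\mathcal{G}$ are used. A strategy of Player $i$ maps each history ending in a vertex of $V_i$ to a successor of that last vertex; $\Sigma_i$ is the set of strategies of Player $i$. $\mathsf{Out}_v(\sigma_0,\sigma_1)$ is the unique play from $v$ consistent with $\sigma_0$ and $\sigma_1$. The game is zero-sum if $w_0(e)=-w_1(e)$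 for all $e\in E$. For a zero-sum game, $\mathsf{Val}_{\mathcal{G}}(\sigma_0)(v)=\inf_{\sigma_1\in\Sigma_1}\underline{\mathsf{MP}}^{\mathcal{G}}_0(\mathsf{Out}_v(\sigma_0,\sigma_1))$. For $\epsilon>0$ and a game $\mathcal{H}$, $\mathsf{BR}^{\epsilon}_{1,\mathcal{H}}(\sigma_0)$ is the set of $\sigma_1\in\Sigma_1$ such that for all $v\in V$ and all $\sigma_1'\in\Sigma_1$: $\underline{\mathsf{MP}}^{\mathcal{H}}_1(\mathsf{Out}_v(\sigma_0,\sigma_1))>\underline{\mathsf{MP}}^{\mathcal{H}}_1(\mathsf{Out}_v(\sigma_0,\sigma_1'))-\epsilon$. For $\delta>0$, $\mathcal{G}^{\pm\delta}$ is the set of games $\mathcal{H}$ with the same $V,E,V_0,V_1$ as $\mathcal{G}$ and with real weight functions $w_0',w_1'$ satisfying $w_i'(e)\in(w_i(e)-\delta,w_i(e)+\delta)$ for all $e\in E$, $i\in\{0,1\}$ ($\mathcal{H}$ need not be zero-sum). Strategies in $\mathcal{G}$ and $\mathcal{H}$ coincide. *)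

(* Defs.v *)
(* MathComp-Analysis. *)
From HB Require Import structures.
From mathcomp Require Import all_boot all_order all_algebra.
From mathcomp Require Import all_classical all_reals all_analysis.

Set Implicit Arguments.
Unset Strict Implicit.
Unset Printing Implicit Defensive.

Import Order.TTheory GRing.Theory Num.Theory.

Local Open Scope classical_set_scope.
Local Open Scope ring_scope.

Variant player := P0 | P1.

(* The partition of the vertices into V_0 and V_1 (either of which may be
   empty) is given by the map [owner]. The weights are kept apart, in [game],
   so that games over the same arena literally share their strategies. *)
Record arena := Arena {
  vertex :> finType;
  edge : rel vertex;
  edge_total : forall x, exists y, edge x y;
  owner : vertex -> player
}.

(* Only the values of [weight i] on pairs (x, y) with [edge x y] are
   meaningful; nothing below depends on the others. *)
Record game (W : Type) (A : arena) := Game {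
  weight : player -> A -> A -> W
}.

Definition real_game (R : realType) (A : arena) (G : game int A) : game R A :=
  Game (fun i x y => (weight G i x y)%:~R).

Definition zero_sum (A : arena) (G : game int A) : Prop :=
  forall x y : A, edge x y -> weight G P0 x y = - weight G P1 x y.

(* The history x_0 x_1 ... x_k is passed as the vertex x_0 and the sequence
   [:: x_1; ...; x_k]; the values of a strategy on other arguments are never
   used. *)
Record strategy (A : arena) (i : player) := Strategy {
  strat_fun :> A -> seq A -> A;
  strat_fun_edge : forall (x : A) (p : seq A),
    path (@edge A) x p -> owner (last x p) = i ->
    edge (last x p) (strat_fun x p)
}.

Definition is_play (A : arena) (pi : nat -> A) : Prop :=
  forall n, edge (pi n) (pi n.+1).

Definition consistent (A : arena) (i : player) (s : strategy A i)
    (pi : nat -> A) : Prop :=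
  forall n, owner (pi n) = i ->
    pi n.+1 = s (pi 0%N) (mkseq (fun j => pi j.+1) n).

Section Outcome.
Variables (A : arena) (v : A) (s0 : strategy A P0) (s1 : strategy A P1).

Definition next_vertex (p : seq A) : A :=
  match owner (last v p) with P0 => s0 v p | P1 => s1 v p end.

Fixpoint out_history (n : nat) : seq A :=
  if n is m.+1 then rcons (out_history m) (next_vertex (out_history m))
  else [::].

Definition Out (n : nat) : A := last v (out_history n).

Lemma OutS n : Out n.+1 = next_vertex (out_history n).
Proof. by rewrite /Out /= last_rcons. Qed.

Lemma out_historyE n : out_history n = mkseq (fun j => Out j.+1) n.
Proof. by elim: n => //= n IH; rewrite mkseqS -IH OutS. Qed.

Lemma Out_is_play : is_play Out.
Proof.
have P n : path (@edge A) v (out_history n) /\ edge (Out n) (Out n.+1).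
  have Pn m : path (@edge A) v (out_history m) -> edge (Out m) (Out m.+1).
    move=> Pm; rewrite OutS /Out /next_vertex.
    by case E : (owner (last v _)); apply: strat_fun_edge.
  elim: n => [|n [IH1 IH2]]; first by split=> //; apply: Pn.
  have Q : path (@edge A) v (out_history n.+1).
    by rewrite /= rcons_path IH1 -OutS.
  by split=> //; apply: Pn.
by move=> n; case: (P n).
Qed.

Lemma Out_consistent : consistent s0 Out /\ consistent s1 Out.
Proof.
by split=> n; rewrite -out_historyE OutS /Out /next_vertex => ->.
Qed.

Lemma Out_unique (pi : nat -> A) :
  pi 0%N = v -> consistent s0 pi -> consistent s1 pi -> pi =1 Out.
Proof.
move=> pi0 c0 c1.
suff H n : mkseq (fun j => pi j.+1) n = out_history n /\ pi n = Out n.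
  by move=> n; case: (H n).
elim: n => [|n [IH1 IH2]] //.
have E : pi n.+1 = Out n.+1.
  rewrite OutS /next_vertex -/(Out n) -IH2.
  by case O : (owner (pi n)); [rewrite c0 | rewrite c1] => //; rewrite pi0 IH1.
by split=> //; rewrite mkseqS IH1 E OutS.
Qed.

End Outcome.

Section Payoff.
Variables (R : realType) (A : arena).
Implicit Types H : game R A.

Definition history_weight H (i : player) (pi : nat -> A) (k : nat) : R :=
  \sum_(0 <= n < k) weight H i (pi n) (pi n.+1).

(* On plays the value is always finite, as there are finitely many edges. *)
Definition MP H (i : player) (pi : nat -> A) : \bar R :=
  limn_einf (fun k => (k%:R^-1 * history_weight H i pi k)%:E).

Definition Val H (s0 : strategy A P0) (v : A) : \bar R :=
  ereal_inf [set MP H P0 (Out v s0 s1) | s1 in [set: strategy A P1]].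

Definition BR (eps : R) H (s0 : strategy A P0) : set (strategy A P1) :=
  [set s1 | forall (v : A) (s1' : strategy A P1),
     (MP H P1 (Out v s0 s1') - eps%:E < MP H P1 (Out v s0 s1))%E].

Definition perturbation (delta : R) (G : game int A) : set (game R A) :=
  [set H | forall (i : player) (x y : A), edge x y ->
     (weight G i x y)%:~R - delta < weight H i x y
       < (weight G i x y)%:~R + delta].

End Payoff.

(* Main.v *)
(* The bound holds against every strategy of Player 1, not only against
   epsilon-best responses: lowering the weights by at most d lowers the payoff
   by at most d. It is strict because there are finitely many edges, so that
   the perturbation is bounded by some d < delta, and Val is finite. *)
Require Import Defs.
From HB Require Import structures.
From mathcomp Require Import all_boot all_order all_algebra.
From mathcomp Require Import all_classical all_reals all_analysis.

Set Implicit Arguments.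
Unset Strict Implicit.
Unset Printing Implicit Defensive.

Import Order.TTheory GRing.Theory Num.Theory.

Local Open Scope classical_set_scope.
Local Open Scope ring_scope.

Lemma le_limn_einf (R : realType) (u v : (\bar R)^nat) :
  (forall n, u n <= v n)%E -> (limn_einf u <= limn_einf v)%E.
Proof.
move=> uv; rewrite !limn_einf_lim; apply: lee_lim; try exact: is_cvg_einfs.
apply: nearW => n; apply: le_ereal_inf_tmp => _ [k /= nk <-].
by apply: le_trans (uv k); apply: ereal_inf_lbound; exists k.
Qed.

(** Each of the [k] edges of a prefix costs at most [d], so every average drops by at most [d], and
    the lower limit keeps this bound. *)
Lemma le_MP_subr (R : realType) (A : arena) (H H' : game R A) (i j : player)
    (d : R) (pi : nat -> A) :
  0 <= d -> (forall x y, edge x y -> weight H i x y - d <= weight H' j x y) ->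
  is_play pi -> (MP H i pi - d%:E <= MP H' j pi)%E.
Proof.
move=> d0 HH' pi_play; rewrite addeC -EFinN -limn_einf_shift//.
apply: le_limn_einf => -[|k]; rewrite -EFinD lee_fin.
  (* At index 0 the inverse of 0 is 0, so both averages vanish and [0 <= d] remains. *)
  by rewrite invr0 !mul0r addr0 oppr_le0.
suff : history_weight H i pi k.+1 - d *+ k.+1 <= history_weight H' j pi k.+1.
  move=> le_weight; rewrite addrC -[d in leLHS](mulKf (_ : k.+1%:R != 0))//.
  by rewrite -mulrBr ler_pM2l ?invr_gt0// mulr_natl.
rewrite -[X in d *+ X]subn0 -sumr_const_nat -sumrB.
by apply: ler_sum => n _; apply: HH'.
Qed.

(** Compare [H], in both directions, with the game [Z] of zero weights, whose payoff is 0; the two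
    differ by at most the largest absolute weight [B]. *)
Lemma MP_bounded (R : realType) (A : arena) (H : game R A) (i : player) :
  exists B : R, forall pi, is_play pi ->
    (- B%:E <= MP H i pi)%E /\ (MP H i pi <= B%:E)%E.
Proof.
pose B := \big[Num.max/0]_(p : A * A) `|weight H i p.1 p.2|.
have le_B x y : `|weight H i x y| <= B by exact: (le_bigmax _ _ (x, y)).
have B0 : 0 <= B by exact: bigmax_ge_id.
pose Z : game R A := Game (fun _ _ _ => 0).
have MPZ pi : MP Z i pi = 0%E.
  rewrite /MP; apply/(cvg_limn_einf_sup _).1.
  rewrite (_ : (fun k => _) = cst 0%E); first exact: cvg_cst.
  by apply/funext => k /=; rewrite /history_weight big1 ?mulr0.
exists B => pi pi_play; split.
  rewrite -[leLHS]add0e -(MPZ pi); apply: le_MP_subr => //= x y _.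
  by rewrite sub0r lerNl (le_trans _ (le_B x y))// -normrN ler_norm.
rewrite -[leRHS]add0e -leeBlDr// -(MPZ pi); apply: le_MP_subr => //= x y _.
by rewrite subr_le0 (le_trans _ (le_B x y))// ler_norm.
Qed.

(** A memoryless choice of successors works. This keeps the infimum in [Val] from ranging over the
    empty set, where it would be infinite. *)
Lemma strategy_inhabited (A : arena) (i : player) : exists s : strategy A i, True.
Proof.
have [f f_edge] := choice (@edge_total A).
by unshelve eexists (@Strategy A i (fun x p => f (last x p)) _).
Qed.

Lemma Val_fin_num (R : realType) (A : arena) (H : game R A)
    (s0 : strategy A P0) (v : A) : Val H s0 v \is a fin_num.
Proof.
have [B MPB] := MP_bounded H P0; rewrite fin_real//; apply/andP; split.
  rewrite (lt_le_trans (ltNyr (- B)))//; apply: le_ereal_inf_tmp => _ [s1 _ <-].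
  exact: (MPB _ (@Out_is_play _ _ _ _)).1.
have [s1 _] := strategy_inhabited A P1.
rewrite (le_lt_trans _ (ltry B))//.
apply: le_trans (MPB _ (@Out_is_play _ v s0 s1)).2.
by apply: ereal_inf_lbound; exists s1.
Qed.

(** Take for [d] the largest decrease of a weight over the finitely many edges, or 0 if no weight
    decreases. Pairs that are not edges are left out, since [perturbation] does not constrain
    them. *)
Lemma perturbation_uniform_bound (R : realType) (A : arena) (G : game int A)
    (delta : R) (H : game R A) (i : player) :
  0 < delta -> perturbation delta G H ->
  exists d : R, [/\ 0 <= d, d < delta & forall x y : A, edge x y ->
    weight (real_game R G) i x y - d <= weight H i x y].
Proof.
move=> delta0 HH.
pose F (p : A * A) := weight (real_game R G) i p.1 p.2 - weight H i p.1 p.2.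
exists (\big[Num.max/0]_(p : A * A | edge p.1 p.2) F p); split.
- exact: bigmax_ge_id.
- apply: bigmax_lt => // -[x y] /= xy; rewrite /F /= ltrBlDr -ltrBlDl.
  by have /andP[+ _] := HH i x y xy.
- move=> x y xy; rewrite lerBlDr -lerBlDl.
  exact: (le_bigmax_cond _ (j := (x, y)) F).
Qed.

Theorem proposition1 (R : realType) (A : arena) (G : game int A)
    (HG : zero_sum G) (s0 : strategy A P0) (v : A) :
  forall delta eps : R, 0 < delta -> 0 < eps ->
  forall H : game R A, perturbation delta G H ->
  (Val (real_game R G) s0 v - delta%:E
     < ereal_inf [set MP H P0 (Out v s0 s1) | s1 in BR eps H s0])%E.
Proof.
move=> delta eps delta0 _ H HH.
have [d [d0 d_delta GH]] := perturbation_uniform_bound P0 delta0 HH.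
apply: (@lt_le_trans _ _ (Val (real_game R G) s0 v - d%:E)%E).
  (* Finiteness of [Val] is essential: adding an infinite value would make both sides equal. *)
  by rewrite lteD2lE ?Val_fin_num// lteN2 lte_fin.
apply: le_ereal_inf_tmp => _ [s1 _ <-].
apply: le_trans (le_MP_subr d0 GH (@Out_is_play _ v s0 s1)).
by rewrite leeD2r//; apply: ereal_inf_lbound; exists s1.
Qed.
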